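(* Let $(X_1,\mu_1),\dots,(X_n,\mu_n)$ be $n$ Polish probability spaces (Polish spaces equipped with Borel probability measures), and let $c:X_1\times\cdots\times X_n\to[0,\infty]$ be a lower semi-continuous Borel measurable function. The following statements hold. (i) For each $j\in\{1,\dots,n\}$, let $R_j:X_j\to X_j$ be a $\mu_j$-measure preserving map. If \[c(x_1,\dots,x_n)=c(R_1x_1,\dots,R_nx_n)\qquad\forall(x_1,\dots,x_n)\in X_1\times\cdots\times X_n,\] then $(MK)$ has a solution $\bar\gamma$ such that $\bar\gamma=(R_1,\dots,R_n)\#\bar\gamma$. (ii) Let $X_1=\cdots=X_n=X$ and $\mu_1=\cdots=\mu_n=\mu$. Let $\mathcal G$ be a set of $\mu$-measure preserving maps on $X$ such that \[c(x_1,\dots,x_n)=c(Ux_1,\dots,Ux_n)\qquad\forall(x_1,\dots,x_n)\in X^n,\ \forall U\in\mathcal G,\] and such that $U\circ R=R\circ U$ for all $U,R\in\mathcal G$. If $\mathcal G$ is a countable set, then $(MK)$ has a solution $\bar\gamma$ that is invariant under $\mathcal G$, i.e. $\bar\gamma=(U,\dots,U)\#\bar\gamma$ for all $U\in\mathcal G$.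
   Context: $\Pi(\mu_1,\dots,\mu_n)$ is the set of Borel probability measures on $X_1\times\cdots\times X_n$ whose $X_i$-marginal is $\mu_i$ for each $i$. The Monge-Kantorovich problem $(MK)$ is \[\inf\Big\{\int_{X_1\times\cdots\times X_n}c\,d\pi;\ \pi\in\Pi(\mu_1,\dots,\mu_n)\Big\};\] a solution is an element of $\Pi(\mu_1,\dots,\mu_n)$ attaining the infimum (the infimum may equal $+\infty$, in which case every plan is a solution). $T\#\mu$ denotes the push-forward of $\mu$ under $T$, and $(R_1,\dots,R_n)$ denotes the map $(x_1,\dots,x_n)\mapsto(R_1x_1,\dots,R_nx_n)$. A map $T:X\to X$ is $\mu$-measure preserving if $T\#\mu=\mu$, i.e. for all $f\in\mathcal L^1(\mu)$ (the $\mu$-integrable functions), $f\circ T\in\mathcal L^1(\mu)$ and $\int_X f\,d\mu=\int_X f\circ T\,d\mu$. *)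

(* Defs.v *)
From HB Require Import structures.
From mathcomp Require Import all_boot all_order all_algebra.
From mathcomp Require Import all_classical all_reals all_analysis.
From mathcomp Require Import measurable_realfun.
Import Order.TTheory GRing.Theory Num.Theory.
Import numFieldNormedType.Exports.

Set Implicit Arguments.
Unset Strict Implicit.
Unset Printing Implicit Defensive.

Local Open Scope classical_set_scope.
Local Open Scope ring_scope.

Definition is_metric (R : realType) (T : Type) (d : T -> T -> R) : Prop :=
  [/\ forall x y, 0 <= d x y,
      forall x y, d x y = 0 <-> x = y,
      forall x y, d x y = d y x &
      forall x y z, d x z <= d x y + d y z].

Definition metric_induces_topology (R : realType) (T : topologicalType)
    (d : T -> T -> R) : Prop :=
  forall (x : T) (A : set T),
    nbhs x A <-> exists2 e : R, 0 < e & [set y | d x y < e] `<=` A.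

Definition metric_complete (R : realType) (T : topologicalType)
    (d : T -> T -> R) : Prop :=
  forall u : nat -> T,
    (forall e : R, 0 < e -> exists N : nat, forall p q : nat,
       (N <= p)%N -> (N <= q)%N -> d (u p) (u q) < e) ->
    exists x : T, u @ \oo --> x.

Definition completely_metrizable (R : realType) (T : topologicalType) : Prop :=
  exists d : T -> T -> R,
    [/\ is_metric d, metric_induces_topology d & metric_complete d].

Definition separable (T : topologicalType) : Prop :=
  exists2 D : set T, countable D & dense D.

(* The topology is part of the data, the metric is not. *)
Definition polish (R : realType) (T : topologicalType) : Prop :=
  completely_metrizable R T /\ separable T.

Definition borel (T : ptopologicalType) : measurableType (@open T).-sigma :=
  g_sigma_algebraType (@open T).

Definition borel_prob (R : realType) (T : ptopologicalType) :=
  probability (borel T) R.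

(* Library measures are total functions on [set T]; only their values on
   measurable sets are meaningful. *)
Definition same_measure (R : realType) (T : ptopologicalType)
    (m1 m2 : set (borel T) -> \bar R) : Prop :=
  forall A : set (borel T), measurable A -> m1 A = m2 A.

Definition borel_push (R : realType) (T U : ptopologicalType)
    (m : set (borel T) -> \bar R) (f : T -> U) : set (borel U) -> \bar R :=
  pushforward m (f : borel T -> borel U).

Definition measure_preserving (R : realType) (T : ptopologicalType)
    (mu : borel_prob R T) (f : T -> T) : Prop :=
  measurable_fun [set: borel T] (f : borel T -> borel T) /\
  same_measure (borel_push mu f) mu.

(* The definition above agrees with the formulation by integrable functions. *)
Lemma measure_preservingP (R : realType) (T : ptopologicalType)
    (mu : borel_prob R T) (f : T -> T) :
  measure_preserving mu f <->
  forall g : borel T -> \bar R, mu.-integrable [set: borel T] g ->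
    mu.-integrable [set: borel T] (g \o f) /\
    (\int[mu]_x g x = \int[mu]_x g (f x))%E.
Proof.
pose F : borel T -> borel T := f.
split=> [[mf inv] g ig|H].
- have mF : measurable_fun [set: borel T] F by [].
  have mg : measurable_fun [set: borel T] g by case/integrableP: ig.
  have igF : mu.-integrable [set: borel T] (g \o F).
    apply/integrableP; split; first exact: measurableT_comp.
    have /integrableP[_] := ig; apply: le_lt_trans.
    rewrite -(@ge0_integral_pushforward _ _ _ _ _ _ mF mu setT (abse \o g)) //; first last.
    + by move=> x _; exact: abse_ge0.
    + exact: measurableT_comp.
    + rewrite le_eqVlt; apply/orP; left; apply/eqP.
      by apply: eq_measure_integral => A mA _; exact: inv.
  split=> //.
  have := integral_pushforward mF mg igF measurableT.
  rewrite preimage_setT => <-.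
  by apply: eq_measure_integral => A mA _; apply/esym; exact: inv.
- have ind A : measurable A ->
     mu.-integrable [set: borel T] (EFin \o \1_A).
    by move=> mA; apply: integrable_indic => //; rewrite ltey_eq fin_num_measure.
  have mpre (A : set (borel T)) : measurable A -> measurable (F @^-1` A).
    move=> mA; have [/measurable_int + _] := H _ (ind _ mA).
    move=> /(_ measurableT [set 1%E] (emeasurable_set1 _)).
    rewrite setTI (_ : _ @^-1` _ = F @^-1` A) //.
    apply/seteqP; split=> x /=; rewrite indicE.
      by case: (boolP (F x \in A)) => [/set_mem//|_ [/eqP]]; rewrite eq_sym oner_eq0.
    by move=> /mem_set ->.
  split; first by move=> _ A mA; rewrite setTI; exact: mpre.
  move=> A mA; have [_] := H _ (ind _ mA).
  rewrite /= integral_indic// setIT => ->.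
  transitivity (\int[mu]_x (\1_(F @^-1` A) x)%:E)%E; last by [].
  by rewrite integral_indic ?setIT//; exact: mpre.
Qed.

HB.instance Definition _ (I : Type) (T : I -> ptopologicalType) :=
  isPointed.Build (prod_topology T) (fun i => point).

Section MongeKantorovich.
Variables (R : realType) (n : nat) (X : 'I_n -> ptopologicalType).

Definition prod_space : ptopologicalType := prod_topology X.

Definition prod_map (f : forall i, X i -> X i) : prod_space -> prod_space :=
  fun x i => f i (x i).

Definition plans (mu : forall i, borel_prob R (X i)) :
    set (borel_prob R prod_space) :=
  [set pi | forall i,
    same_measure (borel_push pi (fun x : prod_space => x i)) (mu i)].

Definition cost (c : prod_space -> \bar R) (pi : borel_prob R prod_space) :
    \bar R :=
  (\int[pi]_x c x)%E.

Definition MK_inf (mu : forall i, borel_prob R (X i))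
    (c : prod_space -> \bar R) : \bar R :=
  ereal_inf [set cost c pi | pi in plans mu].

Definition MK_solution (mu : forall i, borel_prob R (X i))
    (c : prod_space -> \bar R) (pi : borel_prob R prod_space) : Prop :=
  plans mu pi /\ cost c pi = MK_inf mu c.

Definition admissible_cost (c : prod_space -> \bar R) : Prop :=
  [/\ forall x, (0 <= c x)%E,
      lower_semicontinuous c &
      measurable_fun [set: borel prod_space] (c : borel prod_space -> \bar R)].

Definition invariant_under (pi : borel_prob R prod_space)
    (f : forall i, X i -> X i) : Prop :=
  same_measure pi (borel_push pi (prod_map f)).

End MongeKantorovich.

(* Main.v *)
Require Import Defs.
From HB Require Import structures.
From mathcomp Require Import all_boot all_order all_algebra.
From mathcomp Require Import all_classical all_reals all_analysis.
From mathcomp Require Import measurable_realfun lra.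
Import Order.TTheory GRing.Theory Num.Theory.
Import numFieldNormedType.Exports.

Set Implicit Arguments.
Unset Strict Implicit.
Unset Printing Implicit Defensive.

Local Open Scope classical_set_scope.
Local Open Scope ring_scope.

(** Let [L] be a limit, along an ultrafilter on [nat], of the values on Borel
    sets of a sequence of plans. It is finitely additive with marginals [mu j].
    As each [mu j] is inner regular by compact sets, [L] is inner regular by
    compact sets on the algebra generated by the cylinders over Borel sets, so
    it is countably additive there and Caratheodory's theorem turns it into a
    plan [gam]. Open sets are countable unions of rectangles, so
    [gam O <= L O] for [O] open; applied to the superlevel sets of [c] this
    gives lower semicontinuity of the cost, hence a solution. Moreover [gam]
    agrees with [L] on all Borel rectangles, a class stable under preimages by
    [(R_1, ..., R_n)] even though the [R_j] are only measurable; so the limit of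
    Cesaro averages of the push-forwards of a solution is invariant, and the
    averages do not change the measure of a superlevel set of [c]. Averaging
    with respect to a map preserves invariance under the maps commuting with it:
    treating the elements of [G] one after the other and taking one more limit
    gives (ii). *)

(** * Extension of compactly regular finitely additive probabilities *)

Definition set_algebra (T : Type) (A : set (set T)) : Prop :=
  [/\ A set0, setU_closed A & setC_closed A].

(** An alias of [T] that records [G], so that the algebra of sets generated by [G] can be attached
    to it as a canonical structure. *)
Definition g_algebraType (T : pointedType) (G : set (set T)) : Type := T.

Section g_algebra.
Variables (T : pointedType) (G : set (set T)).
Local Notation gA := (smallest (@set_algebra T) G).

Lemma g_algebra0 : gA set0.
Proof. by move=> A [[]]. Qed.

Lemma g_algebraU : setU_closed gA.
Proof.
move=> X Y GX GY A AG; have [[_ AU _] _] := AG.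
by apply: AU; [exact: GX|exact: GY].
Qed.

Lemma g_algebraC : setC_closed gA.
Proof. by move=> X GX A AG; have [[_ _ Ac] _] := AG; apply: Ac; exact: GX. Qed.

Lemma g_algebraI : setI_closed gA.
Proof.
move=> X Y GX GY; rewrite -[X `&` Y]setCK setCI.
by apply: g_algebraC; apply: g_algebraU; exact: g_algebraC.
Qed.

HB.instance Definition _ := Pointed.on (g_algebraType G).
HB.instance Definition _ := isAlgebraOfSets.Build (sigma_display G)
  (g_algebraType G) g_algebra0 g_algebraU g_algebraC.

End g_algebra.

(** Outside the Borel sets only nonnegativity is asked: this covers both [pr mu] and ultrafilter
    limits, which are set to 0 there. *)
Definition finitely_additive_prob (R : realType) (T : ptopologicalType)
    (L : set T -> R) : Prop :=
  [/\ forall A, 0 <= L A, L setT = 1 &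
      forall A B : set T, measurable (A : set (borel T)) ->
        measurable (B : set (borel T)) -> A `&` B = set0 ->
        L (A `|` B) = L A + L B].

Section finitely_additive_prob.
Variables (R : realType) (T : ptopologicalType) (L : set T -> R).
Hypothesis faL : finitely_additive_prob L.
Implicit Types A B : set (borel T).

Let L_ge0 A : 0 <= L A. Proof. by case: faL. Qed.

Lemma fap0 : L set0 = 0.
Proof.
case: faL => _ _ /(_ set0 set0 measurable0 measurable0).
by rewrite setU0 setI0 => /(_ erefl) h; lra.
Qed.

Lemma fapD A B : measurable A -> measurable B -> A `<=` B ->
  L (B `\` A) = L B - L A.
Proof.
move=> mA mB AB; case: faL => _ _ /(_ A (B `\` A) mA).
by rewrite setDUK// => ->; [lra|exact: measurableD|exact: setDIK].
Qed.

Lemma le_fap A B : measurable A -> measurable B -> A `<=` B -> L A <= L B.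
Proof.
by move=> mA mB AB; have := fapD mA mB AB; have := L_ge0 (B `\` A); lra.
Qed.

Lemma fapU_le A B : measurable A -> measurable B ->
  L (A `|` B) <= L A + L B.
Proof.
move=> mA mB; case: faL => _ _ /(_ A (B `\` A) mA (measurableD mB mA)).
move=> h.
have -> : A `|` B = A `|` (B `\` A).
  by rewrite -(setDUK (@subsetUl _ A B)) setDUl setDv set0U.
rewrite h; last exact: setDIK.
by rewrite lerD2l; apply: le_fap => //; exact: measurableD.
Qed.

Lemma fap_bigsetU_le (I : Type) (s : seq I) (F : I -> set (borel T)) :
  (forall i, measurable (F i)) ->
  L (\big[setU/set0]_(i <- s) F i) <= \sum_(i <- s) L (F i).
Proof.
move=> mF; elim: s => [|i s ih]; first by rewrite !big_nil fap0.
rewrite !big_cons (le_trans (fapU_le _ _))//; last by rewrite lerD2l.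
exact: bigsetU_measurable.
Qed.

End finitely_additive_prob.

Section normed_measure.
Variables (R : realType) (d : measure_display) (T : measurableType d).
Variables (m : {measure set T -> \bar R}) (mT : m setT = 1%E).

(* The vacuous [let] makes the probability instance depend on [mT]. *)
Definition normed_measure : set T -> \bar R := let _ := mT in m.

HB.instance Definition _ := Measure.on normed_measure.
HB.instance Definition _ :=
  Measure_isProbability.Build _ _ _ normed_measure mT.

End normed_measure.

Lemma pushforward_probability (R : realType) d d' (T : measurableType d)
    (U : measurableType d') (m : {measure set T -> \bar R}) (f : T -> U) :
  measurable_fun setT f -> m setT = 1%E ->
  exists P : probability U R, forall A, P A = m (f @^-1` A).
Proof.
move=> mf mT.
pose f' : {mfun T >-> U} := HB.pack f (isMeasurableFun.Build _ _ _ _ f mf).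
by exists (distribution (normed_measure mT) f').
Qed.

(** The exponents start at 2 so that errors [e / 2^(i+2)] add up to at most [e / 2]. *)
Lemma sum_half_le (R : realType) n :
  \sum_(i < n) (2^-1 : R) ^+ i.+2 <= 2^-1.
Proof.
suff -> : \sum_(i < n) (2^-1 : R) ^+ i.+2 = 2^-1 - 2^-1 ^+ n.+1.
  by rewrite gerBl exprn_ge0// invr_ge0.
elim: n => [|n ih]; first by rewrite big_ord0 expr1 subrr.
by rewrite big_ord_recr/= ih !exprS; lra.
Qed.

Section compact_extension.
Variables (R : realType) (T : ptopologicalType) (L : set T -> R).
Variable G : set (set T).
Hypothesis faL : finitely_additive_prob L.
Hypothesis GT : G setT.
Hypothesis GC : setC_closed G.
Hypothesis GB : G `<=` (measurable : set (set (borel T))).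

(** Closedness is asked besides compactness because [T] is not assumed Hausdorff; it makes [K] a
    Borel set. *)
Definition compactly_regular (A : set T) : Prop := forall e : R, 0 < e ->
  exists K : set T, [/\ compact K, closed K, K `<=` A & L (A `\` K) < e].

Hypothesis Greg : forall A, G A -> compactly_regular A.
Hypothesis Gopen : forall O : set T, open O ->
  exists2 F : nat -> set T, (forall i, smallest (@set_algebra T) G (F i)) &
    O = \bigcup_i F i.

Lemma closed_borel (K : set T) : closed K -> measurable (K : set (borel T)).
Proof.
move=> cK; rewrite -[K]setCK; apply: measurableC; apply: sub_sigma_algebra.
exact: closed_openC.
Qed.

Lemma compactly_regularU (A B : set T) :
  measurable (A : set (borel T)) -> measurable (B : set (borel T)) ->
  compactly_regular A -> compactly_regular B -> compactly_regular (A `|` B).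
Proof.
move=> mA mB rA rB e e0; have e2 : 0 < e / 2 by lra.
have [K [cK clK KA LK]] := rA _ e2; have [K' [cK' clK' KB LK']] := rB _ e2.
exists (K `|` K'); split; [exact: compactU|exact: closedU|exact: setUSS|].
have mK := closed_borel clK; have mK' := closed_borel clK'.
apply: (@le_lt_trans _ _ (L ((A `\` K) `|` (B `\` K')))); last first.
  apply: le_lt_trans (fapU_le faL _ _) _; [exact: measurableD..|].
  by rewrite [e]splitr ltrD.
apply: le_fap => //.
- by apply: measurableD; exact: measurableU.
- by apply: measurableU; exact: measurableD.
- by move=> x [[Ax|Bx] /not_orP[Kx K'x]]; [left|right].
Qed.

Lemma compactly_regularI (A B : set T) :
  measurable (A : set (borel T)) -> measurable (B : set (borel T)) ->
  compactly_regular A -> compactly_regular B -> compactly_regular (A `&` B).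
Proof.
move=> mA mB rA rB e e0; have e2 : 0 < e / 2 by lra.
have [K [cK clK KA LK]] := rA _ e2; have [K' [cK' clK' KB LK']] := rB _ e2.
have mK := closed_borel clK; have mK' := closed_borel clK'.
exists (K `&` K'); split; [|exact: closedI|exact: setISS|].
  by apply: subclosed_compact cK _; [exact: closedI|exact: subIsetl].
apply: (@le_lt_trans _ _ (L ((A `\` K) `|` (B `\` K')))); last first.
  apply: le_lt_trans (fapU_le faL _ _) _; [exact: measurableD..|].
  by rewrite [e]splitr ltrD.
apply: le_fap => //.
- by apply: measurableD; exact: measurableI.
- by apply: measurableU; exact: measurableD.
- by move=> x [[Ax Bx] /not_andP[Kx|K'x]]; [left|right].
Qed.

Lemma g_algebra_regular (A : set T) : smallest (@set_algebra T) G A ->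
  [/\ measurable (A : set (borel T)), compactly_regular A &
      compactly_regular (~` A)].
Proof.
move: A; apply: smallest_sub => [|A GA]; last first.
  by split; [exact: GB|exact: Greg|apply: Greg; exact: GC].
have reg0 : compactly_regular set0.
  move=> e e0; exists set0; split => //; [exact: compact0|exact: closed0|].
  by rewrite setD0 (fap0 faL).
split.
- by split; [exact: measurable0|exact: reg0|rewrite setC0; exact: Greg].
- move=> A B [mA rA rAc] [mB rB rBc]; split; first exact: measurableU.
    exact: compactly_regularU.
  by rewrite setCU; apply: compactly_regularI => //; exact: measurableC.
- by move=> A [mA rA rAc]; split => //; [exact: measurableC|rewrite setCK].
Qed.

Let alg := g_algebraType G.

Definition fap_content (A : set alg) : \bar R := (L A)%:E.

Let content_ge0 A : (0 <= fap_content A)%E.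
Proof. by rewrite lee_fin; case: faL. Qed.

Let content_semi_additive : measure_function.semi_additive fap_content.
Proof.
apply: (additive2P _).2; rewrite /fap_content ?(fap0 faL)// => A B mA mB AB.
have [mA' _ _] := g_algebra_regular mA; have [mB' _ _] := g_algebra_regular mB.
by rewrite -EFinD; congr EFin; case: faL => _ _; exact.
Qed.

HB.instance Definition _ :=
  isContent.Build _ alg R fap_content content_ge0 content_semi_additive.

Let content_sigma_subadditive : measurable_subset_sigma_subadditive fap_content.
Proof.
move=> A F mF mA AF; apply/lee_addgt0Pr => e e0.
have [mA' rA _] := g_algebra_regular mA.
have mF' n : measurable (F n : set (borel T)).
  by have [] := g_algebra_regular (mF n).
have [|K [cK clK KA LK]] := rA (e / 2); first by lra.
have /choice[K' HK'] : forall n, exists K', [/\ closed K', K' `<=` ~` F n &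
    L (~` F n `\` K') < e * 2^-1 ^+ n.+2].
  move=> n; have [_ _ rF] := g_algebra_regular (mF n).
  have [|K' [_ clK' KF LK']] := rF (e * 2^-1 ^+ n.+2); last by exists K'.
  by rewrite mulr_gt0// exprn_gt0// invr_gt0.
have mK := closed_borel clK.
have mK' n : measurable (K' n : set (borel T)).
  by apply: closed_borel; case: (HK' n).
have FK n : F n `<=` ~` K' n.
  by have [_ h _] := HK' n => x Fx /h.
have LK'n n : L (~` K' n) <= L (F n) + e * 2^-1 ^+ n.+2.
  have [_ _ h] := HK' n; have := fapD faL (mF' n) (measurableC (mK' n)) (FK n).
  rewrite (_ : ~` K' n `\` F n = ~` F n `\` K' n); first by move: h; lra.
  by rewrite !setDE setIC.
have : exists N, K `<=` \big[setU/set0]_(i < N) ~` K' i.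
  move: cK; rewrite compact_cover => /(_ nat setT (fun i => ~` K' i)) [].
  - by move=> i _; apply: closed_openC; case: (HK' i).
  - by move=> x /KA/AF[i _ Fx]; exists i => //; exact: FK.
  (* The finite index set [D] is enlarged to an initial segment; the successor accounts for the
     strict bound [i < N]. *)
  - move=> D _ KD; exists (\max_(i <- finmap.enum_fset D) i.+1)%N.
    move=> x /KD[i /= iD Kix].
    rewrite -(bigcup_mkord _ (fun i => ~` K' i)); exists i => //=.
    by rewrite (leq_trans _ (leq_bigmax_seq _ iD _)).
case=> N KN; have LKN : L K <= \sum_(i < N) L (~` K' i).
  have mCK i : measurable (~` K' i : set (borel T)) by exact: measurableC.
  apply: le_trans (fap_bigsetU_le faL _ (F := fun i : 'I_N => ~` K' i) _) => //.
  by apply: le_fap => //; apply: bigsetU_measurable => i _; exact: measurableC.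
have LAN : L A <= \sum_(i < N) L (F i) + e.
  have := fapD faL mK mA' KA.
  have : \sum_(i < N) L (~` K' i) <=
      \sum_(i < N) L (F i) + e * \sum_(i < N) 2^-1 ^+ i.+2.
    by rewrite mulr_sumr -big_split/=; apply: ler_sum => i _.
  have : e * \sum_(i < N) 2^-1 ^+ i.+2 <= e * 2^-1.
    by rewrite ler_pM2l// sum_half_le.
  by move: LKN LK; lra.
apply: (@le_trans _ _ ((\sum_(i < N) L (F i))%:E + e%:E)%E).
  by rewrite -EFinD lee_fin.
rewrite leeD2r// -sumEFin -(big_mkord xpredT (fun i => (L (F i))%:E)).
by apply: nneseries_lim_ge => i _ _; exact: content_ge0.
Qed.

HB.instance Definition _ :=
  Content_SigmaSubAdditive_isMeasure.Build _ R alg fap_content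
  content_sigma_subadditive.

Let salg : measurableType _ := g_sigma_algebraType (@measurable _ alg).

(** By [Gopen], the sigma-algebra on which Caratheodory's extension lives contains the open sets. *)
Let borel_sub_salg (A : set (borel T)) :
  measurable A -> measurable (A : set salg).
Proof.
move: A; apply: smallest_sub.
  split; [exact: measurable0|by move=> A mA; rewrite setTD; exact: measurableC|].
  by move=> A mA; exact: bigcupT_measurable.
move=> O /Gopen[F GF ->]; apply: bigcupT_measurable => i.
by apply: sub_sigma_algebra; exact: GF.
Qed.

Lemma compact_extension : exists gam : borel_prob R T,
  (forall A, smallest (@set_algebra T) G A -> gam A = (L A)%:E) /\
  (forall O : set T, open O -> (gam O <= (L O)%:E)%E).
Proof.
(* Pushing the Caratheodory extension forward along the identity restricts it to the Borel sets. *)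
pose h : salg -> borel T := idfun.
have mh : measurable_fun setT h by move=> _ A /borel_sub_salg; rewrite setTI.
have extE A : smallest (@set_algebra T) G A ->
    measure_extension fap_content A = (L A)%:E.
  by move=> GA; rewrite /measure_extension measurable_mu_extE.
have [|gam gamE] :=
    pushforward_probability (m := measure_extension fap_content) mh.
  by apply: etrans (extE setT _) _; [exact: sub_gen_smallest|case: faL => _ ->].
exists gam; split=> [A GA|O oO]; first by rewrite gamE; exact: extE.
have [F GF OF] := Gopen oO.
(* The finite unions [U n] belong to the algebra, so [gam (U n)] is [L (U n)], which is at most
   [L O]. Only [gam] is continuous from below, hence an inequality in the limit. *)
pose U n := \big[setU/set0]_(i < n.+1) F i.
have GU n : smallest (@set_algebra T) G (U n).
  rewrite /U; elim: n.+1 => {n} [|n ih].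
    by rewrite big_ord0; exact: g_algebra0.
  by rewrite big_ord_recr; exact: g_algebraU.
have mU n : measurable (U n : set (borel T)).
  by have [] := g_algebra_regular (GU n).
have mO : measurable (O : set (borel T)) by exact: sub_sigma_algebra.
have UO : \bigcup_n U n = O by rewrite OF; exact: bigcup_bigsetU_bigcup.
have cU : gam (U n) @[n --> \oo] --> gam O.
  rewrite -UO; apply: nondecreasing_cvg_mu => //; first by rewrite UO.
  by move=> m n mn; apply/subsetPset; exact: subset_bigsetU.
rewrite -(cvg_lim _ cU)//; apply: lime_le; first by apply/cvg_ex; exists (gam O).
apply: nearW => n; rewrite (_ : gam (U n) = (L (U n))%:E); last first.
  by rewrite gamE; exact: extE _ (GU n).
rewrite lee_fin; apply: le_fap => //.
by rewrite -UO; exact: bigcup_sup.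
Qed.

End compact_extension.

(** * Inner regularity of Borel probabilities on Polish spaces *)

Section probability_real.
Variables (R : realType) (T : ptopologicalType) (mu : borel_prob R T).
Implicit Types A : set (borel T).

Definition pr (A : set T) : R := fine (mu A).

Lemma prE A : measurable A -> mu A = (pr A)%:E.
Proof. by move=> mA; rewrite /pr fineK// fin_num_measure. Qed.

Lemma pr_finitely_additive : finitely_additive_prob pr.
Proof.
split => [A||A B mA mB AB].
- by rewrite fine_ge0.
- by rewrite /pr probability_setT.
- by rewrite /pr measureU// fineD// fin_num_measure.
Qed.

Lemma pr_bigcup_half (C : nat -> set (borel T)) (e : R) : 0 <= e ->
  (forall m, measurable (C m)) ->
  (forall m, pr (C m) <= e * 2^-1 ^+ m.+2) -> pr (\bigcup_m C m) <= e / 2.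
Proof.
move=> e0 mC Ce; rewrite -lee_fin -prE; last exact: bigcupT_measurable.
have mUC : measurable (\bigcup_m C m) by exact: bigcupT_measurable.
have h0 := @measure_function.measure_sigma_subadditive _ R _ mu _ C mC mUC
  (@subset_refl _ _).
apply: (le_trans h0).
apply: lime_le; first by apply: is_cvg_nneseries.
apply: nearW => n; rewrite big_mkord.
rewrite (eq_bigr (fun i : 'I_n => (pr (C i))%:E)); last first.
  by move=> i _; exact: prE.
rewrite sumEFin lee_fin.
apply: (@le_trans _ _ (\sum_(i < n) e * 2^-1 ^+ i.+2)); first exact: ler_sum.
by rewrite -mulr_sumr ler_wpM2l// sum_half_le.
Qed.

Lemma pr_nondecreasing_approx (F : nat -> set (borel T)) (B : set (borel T)) e :
  (forall n, measurable (F n)) -> (forall n, F n `<=` F n.+1) ->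
  \bigcup_n F n = B -> 0 < e -> exists n, pr (B `\` F n) < e.
Proof.
move=> mF Fincr FB e0.
have mB : measurable B by rewrite -FB; exact: bigcupT_measurable.
have ndF : nondecreasing_seq F.
  by apply/nondecreasing_seqP => n; apply/subsetPset.
have cF : mu (F n) @[n --> \oo] --> mu B.
  by rewrite -FB; apply: nondecreasing_cvg_mu => //; rewrite FB.
have : pr (F n) @[n --> \oo] --> pr B.
  by apply: (fine_cvg _); rewrite -prE.
move=> /cvgrPdist_lt/(_ e e0)[n _ /(_ n (leqnn n))] /=.
have FnB : F n `<=` B by rewrite -FB; exact: bigcup_sup.
rewrite -(fapD pr_finitely_additive (mF n) mB FnB) => h.
by exists n; exact: le_lt_trans (ler_norm _) h.
Qed.

End probability_real.

Section polish_regularity.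
Variables (R : realType) (T : ptopologicalType) (mu : borel_prob R T).
Variable d : T -> T -> R.
Hypothesis dm : is_metric d.
Hypothesis dtop : metric_induces_topology d.
Hypothesis dcomplete : metric_complete d.
Hypothesis Tsep : separable T.

Let dxx x : d x x = 0. Proof. by case: dm => _ /(_ x x)[_ ->]. Qed.
Let dC x y : d x y = d y x. Proof. by case: dm. Qed.
Let dtri x y z : d x z <= d x y + d y z. Proof. by case: dm. Qed.

Let faL := pr_finitely_additive mu.

Lemma metric_ball_open x e : open [set y | d x y < e].
Proof.
rewrite openE => y /= xy; apply/dtop; exists (e - d x y); first by lra.
by move=> z /=; have := dtri x y z; lra.
Qed.

Lemma metric_cball_closed x e : closed [set y | d x y <= e].
Proof.
rewrite -openC openE => y /= /negP; rewrite -ltNge => xy.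
apply/dtop; exists (d x y - e); first by lra.
move=> z /= yz; apply/negP; rewrite -ltNge.
by have := dtri x z y; rewrite (dC z y); lra.
Qed.

Lemma dense_sequence : exists g : nat -> T,
  forall x e, 0 < e -> exists n, d (g n) x < e.
Proof.
have [D /countable_injP[f finj] Dd] := Tsep.
(* The sequence inverts an injection [f] of [D] into the integers, with the default [point] outside
   its range. *)
exists (fun n => xget point [set x | D x /\ f x = n]) => x e e0.
have [||y [xy Dy]] := Dd [set y | d x y < e].
- by exists x; rewrite /= dxx.
- exact: metric_ball_open.
exists (f y); case: xgetP => [z _ [Dz fz]|nP]; last first.
  by exfalso; exact: (nP y).
by rewrite (finj _ _ _ _ fz) ?inE// dC.
Qed.

Lemma ultra_bigsetU (F : set_system T) (A : nat -> set T) n :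
  UltraFilter F -> F (\big[setU/set0]_(i < n) A i) -> exists i, F (A i).
Proof.
move=> FU; elim: n => [|n ih].
  by rewrite big_ord0 => F0; exfalso; exact: (filter_not_empty F).
rewrite big_ord_recr/= => FAn.
have [FA|FA] := in_ultra_setVsetC (A n) FU; first by exists n.
apply: ih; apply: filterS (filterI FAn FA) => x [[//|Ax] nAx].
by exfalso; exact: nAx.
Qed.

(** Points [u p] chosen in the intersection of the first [p.+1] balls form a Cauchy sequence, since
    [u p] and [u q] lie in ball [m] when [p] and [q] are at least [m]. Its limit is a limit of [F]
    because small balls belong to [F]. *)
Lemma complete_ultra_cvg (F : set_system T) (g : nat -> T) :
  UltraFilter F -> (forall m, F [set y | d (g m) y <= m.+1%:R^-1]) ->
  exists x : T, F --> x.
Proof.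
move=> FU Fg.
pose A p :=
  \bigcap_(m in [set m | (m <= p)%N]) [set y | d (g m) y <= m.+1%:R^-1].
have FA p : F (A p).
  rewrite /A (_ : [set m | (m <= p)%N] = `I_p.+1)//.
  elim: p => [|p ih].
    by apply: filterS (Fg 0) => y Fy m; rewrite /= ltnS leqn0 => /eqP ->.
  apply: filterS (filterI ih (Fg p.+1)) => y [h1 h2] m /=.
  by rewrite ltnS leq_eqVlt => /orP[/eqP ->//|]; exact: h1.
have /choice[u uA] : forall p, exists y, A p y.
  by move=> p; exact: filter_ex (FA p).
have close m p y : (m <= p)%N -> d (g m) y <= m.+1%:R^-1 ->
    d (u p) y <= m.+1%:R^-1 + m.+1%:R^-1.
  move=> mp gy; have gu : d (g m) (u p) <= m.+1%:R^-1 := uA p m mp.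
  by rewrite (le_trans (dtri _ (g m) _))// lerD// dC.
have small (e : R) : 0 < e -> exists m : nat, m.+1%:R^-1 + m.+1%:R^-1 < e.
  move=> e0; have e2 : 0 < e / 2 by lra.
  have [m _ /(_ m (leqnn m))/= h] := near_infty_natSinv_lt (PosNum e2).
  by exists m; rewrite [e]splitr ltrD.
have [|x ux] := dcomplete (u := u).
  move=> e /small[m me]; exists m => p q mp mq.
  by apply: le_lt_trans me; apply: close => //; exact: uA.
exists x => B /dtop[e e0 eB].
have e2 : 0 < e / 2 by lra.
have [m me] := small _ e2.
have : nbhs x [set y | d x y < e / 2] by apply/dtop; exists (e / 2).
move=> /ux[N _ hN]; have := hN (maxn N m) (leq_maxl _ _) => /= xu.
apply: filterS (Fg m) => y /= gy; apply: eB => /=.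
apply: le_lt_trans (dtri x (u (maxn N m)) y) _.
rewrite [e]splitr ltrD//; apply: le_lt_trans me.
by apply: close => //; exact: leq_maxr.
Qed.

(** Ulam's theorem. For each [m], finitely many closed balls of radius [1 / (m+1)] centred on a
    dense sequence cover all but mass [e / 2^(m+2)]. The intersection over [m] of these finite
    unions is closed and totally bounded, hence compact by completeness. *)
Lemma polish_tight : compactly_regular (pr mu) setT.
Proof.
move=> e e0; have [g gd] := dense_sequence.
pose B m k := [set y | d (g k) y <= m.+1%:R^-1].
pose S m n := \big[setU/set0]_(k < n) B m k.
have clS m n : closed (S m n).
  by apply: closed_bigsetU => k _; exact: metric_cball_closed.
have mS m n := closed_borel (clS m n).
have /choice[N HN] : forall m, exists N, pr mu (~` S m N) < e * 2^-1 ^+ m.+2.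
  move=> m.
  have [||||n hn] :=
      @pr_nondecreasing_approx _ _ mu (S m) setT (e * 2^-1 ^+ m.+2).
  - exact: mS.
  - by move=> n; rewrite /S big_ord_recr/=; exact: subsetUl.
  - apply/seteqP; split => // x _.
    have [|k gk] := gd x m.+1%:R^-1; first by rewrite invr_gt0.
    exists k.+1 => //; rewrite /S big_ord_recr/=; right.
    exact: ltW.
  - by rewrite mulr_gt0// exprn_gt0// invr_gt0.
  - by exists n; rewrite -setTD.
pose K := \bigcap_m S m (N m).
have clK : closed K by apply: closed_bigI => m _.
exists K; split => //; last first.
  rewrite setTD setC_bigcap; apply: (@le_lt_trans _ _ (e / 2)); last by lra.
  apply: pr_bigcup_half; first exact: ltW.
    by move=> m; exact: measurableC.
  by move=> m; exact: ltW.
rewrite compact_ultra => F FU FK.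
(* An ultrafilter containing a finite union of balls contains one of them. *)
have /choice[k Hk] : forall m, exists k, F (B m k).
  move=> m; apply: (ultra_bigsetU (n := N m)).
  by apply: filterS FK => x /(_ m); exact.
have [x Fx] := complete_ultra_cvg FU Hk.
exists x; split => //; rewrite (closure_id K).1// => C /Fx FC.
exact: filter_ex (filterI FK FC).
Qed.

Lemma compactly_regular_trans (B : set T) : measurable (B : set (borel T)) ->
  (forall e, 0 < e -> exists F : set (borel T), [/\ measurable F,
     compactly_regular (pr mu) F, F `<=` B & pr mu (B `\` F) < e]) ->
  compactly_regular (pr mu) B.
Proof.
move=> mB BF e e0; have e2 : 0 < e / 2 by lra.
have [F [mF rF FB LF]] := BF _ e2; have [K [cK clK KF LK]] := rF _ e2.
have mK := closed_borel clK.
exists K; split => //; first exact: subset_trans KF FB.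
apply: (@le_lt_trans _ _ (pr mu ((B `\` F) `|` (F `\` K)))); last first.
  apply: le_lt_trans (fapU_le faL _ _) _; [exact: measurableD..|].
  by rewrite [e]splitr ltrD.
apply: (le_fap faL); [exact: measurableD|apply: measurableU; exact: measurableD|].
by move=> x [Bx Kx]; have [Fx|Fx] := pselect (F x); [right|left].
Qed.

Lemma polish_regular_closed (C : set T) : closed C ->
  compactly_regular (pr mu) C.
Proof.
move=> clC; have mC := closed_borel clC => e e0.
have [K [cK clK _ LK]] := polish_tight e0.
exists (C `&` K); split => //; [|exact: closedI|].
  by apply: subclosed_compact cK _; [exact: closedI|exact: subIsetr].
apply: le_lt_trans LK; apply: (le_fap faL).
- by apply: measurableD => //; apply: measurableI => //; exact: closed_borel.
- by apply: measurableD => //; exact: closed_borel.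
- by move=> x [Cx /not_andP[//|Kx]]; split.
Qed.

Lemma polish_regular_open (O : set T) : open O ->
  compactly_regular (pr mu) O.
Proof.
move=> oO; have mO : measurable (O : set (borel T)) by exact: sub_sigma_algebra.
(* The points at distance at least [1 / (n+1)] from the complement of [O]: closed sets increasing to
   [O]. *)
pose F n := ~` \bigcup_(y in ~` O) [set x | d y x < n.+1%:R^-1].
have clF n : closed (F n).
  by apply: open_closedC; apply: bigcup_open => y _; exact: metric_ball_open.
apply: compactly_regular_trans => // e e0.
have [||||n Fn] := @pr_nondecreasing_approx _ _ mu F O e.
- by move=> n; exact: closed_borel.
- move=> n x; apply: contra_not => -[y Oy /= yx]; exists y => //=.
  by apply: lt_le_trans yx _; rewrite lef_pV2 ?posrE// ler_nat.
- apply/seteqP; split=> [x [n _ Fx]|x Ox].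
    by apply: contrapT => nOx; apply: Fx; exists x => //=; rewrite dxx invr_gt0.
  have /dtop[r r0 rO] : nbhs x O by exact: open_nbhs_nbhs.
  have [n _ /(_ n (leqnn n))/= h] := near_infty_natSinv_lt (PosNum r0).
  exists n => // -[y nOy /= yx]; apply: nOy; apply: rO => /=.
  by rewrite dC; exact: lt_trans yx h.
- exact: e0.
exists (F n); split => //; [exact: closed_borel|exact: polish_regular_closed|].
move=> x Fx; apply: contrapT => nOx; apply: Fx; exists x => //=.
by rewrite dxx invr_gt0.
Qed.

Lemma compactly_regular_bigcup (B : nat -> set (borel T)) :
  (forall n, measurable (B n)) -> (forall n, compactly_regular (pr mu) (B n)) ->
  compactly_regular (pr mu) (\bigcup_n B n).
Proof.
move=> mB rB; apply: compactly_regular_trans; first exact: bigcupT_measurable.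
move=> e e0; pose F n := \big[setU/set0]_(i < n.+1) B i.
have mF n : measurable (F n) by exact: bigsetU_measurable.
have [||||n Fn] := @pr_nondecreasing_approx _ _ mu F (\bigcup_n B n) e => //.
- by move=> n; rewrite /F [X in _ `<=` X]big_ord_recr/=; exact: subsetUl.
- exact: bigcup_bigsetU_bigcup.
exists (F n); split => //; last first.
  by rewrite -bigcup_bigsetU_bigcup; exact: bigcup_sup.
rewrite /F; elim: n.+1 => {n Fn} [|n ih].
  rewrite big_ord0 => r r0; exists set0; split => //.
  - exact: compact0.
  - exact: closed0.
  - by rewrite setD0 (fap0 faL).
rewrite big_ord_recr/=; apply: (compactly_regularU faL) => //.
exact: bigsetU_measurable.
Qed.

(** Compact sets [K n] inside [B n], with errors [e / 2^(n+2)], are intersected; the result is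
    compact as a closed part of [K 0]. *)
Lemma compactly_regular_bigcap (B : nat -> set (borel T)) :
  (forall n, measurable (B n)) -> (forall n, compactly_regular (pr mu) (B n)) ->
  compactly_regular (pr mu) (\bigcap_n B n).
Proof.
move=> mB rB e e0.
have /choice[K HK] : forall n, exists K : set T, [/\ compact K, closed K,
    K `<=` B n & pr mu (B n `\` K) < e * 2^-1 ^+ n.+2].
  by move=> n; apply: rB; rewrite mulr_gt0// exprn_gt0// invr_gt0.
have clK n : closed (K n) by case: (HK n).
have mK n := closed_borel (clK n).
have clKI : closed (\bigcap_n K n) by apply: closed_bigI => n _.
exists (\bigcap_n K n); split => //.
- have [cK0 _ _ _] := HK 0%N; apply: (subclosed_compact clKI cK0).
  exact: bigcap_inf.
- by move=> x Kx n _; have [_ _ + _] := HK n; apply; exact: Kx.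
- have mBK n : measurable (B n `\` K n) by exact: measurableD.
  apply: (@le_lt_trans _ _ (pr mu (\bigcup_n (B n `\` K n)))).
    apply: (le_fap faL).
    + by apply: measurableD; [exact: bigcapT_measurable|exact: closed_borel].
    + exact: bigcupT_measurable.
    + move=> x [Bx /existsNP[n /not_implyP[_ Kx]]].
      by exists n => //; split => //; exact: Bx.
  apply: (@le_lt_trans _ _ (e / 2)); last by lra.
  apply: pr_bigcup_half => //; first exact: ltW.
  by move=> n; have [_ _ _ /ltW] := HK n.
Qed.

(** The sets that are regular together with their complement form a sigma-algebra containing the
    open sets. *)
Lemma borel_compactly_regular (B : set (borel T)) : measurable B ->
  compactly_regular (pr mu) B.
Proof.
move=> mB; suff [] : [/\ measurable B, compactly_regular (pr mu) B &
  compactly_regular (pr mu) (~` B)] by [].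
move: B mB; apply: smallest_sub; last first.
  move=> O oO; split; [exact: sub_sigma_algebra|exact: polish_regular_open|].
  by apply: polish_regular_closed; exact: open_closedC.
split.
- split; [exact: measurable0|apply: polish_regular_open; exact: open0|].
  by rewrite setC0; exact: polish_tight.
- move=> A [mA rA rAc]; rewrite setTD.
  by split => //; [exact: measurableC|rewrite setCK].
- move=> A HA; split.
  + by apply: bigcupT_measurable => n; case: (HA n).
  + by apply: compactly_regular_bigcup => n; case: (HA n).
  + rewrite setC_bigcup; apply: compactly_regular_bigcap => n.
      by apply: measurableC; case: (HA n).
    by case: (HA n).
Qed.

End polish_regularity.

Lemma polish_compactly_regular (R : realType) (T : ptopologicalType)
    (mu : borel_prob R T) (B : set (borel T)) :
  polish R T -> measurable B -> compactly_regular (pr mu) B.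
Proof.
move=> [[d [dm dtop dcomplete]] Tsep] mB.
exact: (borel_compactly_regular mu dm dtop dcomplete Tsep mB).
Qed.

(** * Rectangles in a finite product of Polish spaces *)

Lemma polish_countable_basis (R : realType) (T : ptopologicalType) :
  polish R T -> exists2 W : nat -> set T, (forall k, open (W k)) &
    forall x A, nbhs x A -> exists2 k, W k x & W k `<=` A.
Proof.
move=> [[d [dm dtop _]] Tsep]; have [g gd] := dense_sequence dm dtop Tsep.
have dC x y : d x y = d y x by case: dm.
have dtri x y z : d x z <= d x y + d y z by case: dm.
(* The integer [k] codes a pair: index of the centre, index of the radius. Integers coding no pair
   give the empty set. *)
exists (fun k => if @unpickle (nat * nat)%type k is Some ab
                 then [set y | d (g ab.1) y < ab.2.+1%:R^-1] else set0).
  move=> k; case: unpickle => [ab|]; last exact: open0.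
  exact: metric_ball_open.
move=> x A /dtop[e e0 eA]; have e2 : 0 < e / 2 by lra.
have [b _ /(_ b (leqnn b))/= be] := near_infty_natSinv_lt (PosNum e2).
have [|a gax] := gd x b.+1%:R^-1; first by rewrite invr_gt0.
exists (pickle (a, b)); rewrite pickleK//= => y /= gay; apply: eA => /=.
rewrite (le_lt_trans (dtri _ (g a) _))// [e]splitr ltrD//.
  by rewrite dC (lt_trans gax).
exact: lt_trans gay be.
Qed.

Section product.
Variables (R : realType) (n : nat) (X : 'I_n -> ptopologicalType).
Hypothesis n_gt0 : (0 < n)%N.
Hypothesis Xpolish : forall j, polish R (X j).
Local Notation P := (prod_space X).

Definition rect (B : forall j, set (X j)) : set P :=
  [set x | forall j, B j (x j)].

Definition measurable_rect (A : set P) : Prop :=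
  exists2 B : forall j, set (X j),
    (forall j, measurable (B j : set (borel (X j)))) & A = rect B.

(** Unlike rectangles, cylinders over one coordinate are stable under complement, as
    [compact_extension] requires of its generators. *)
Definition cylinder (A : set P) : Prop :=
  exists i, exists2 B : set (X i), measurable (B : set (borel (X i))) &
    A = [set x : P | B (x i)].

Lemma prod_proj_continuous i : continuous (fun x : P => x i).
Proof. exact: (@proj_continuous _ _ i). Qed.

Lemma prod_proj_measurable i :
  measurable_fun [set: borel P] (fun x : borel P => (x i : borel (X i))).
Proof.
apply: (@measurability _ _ (borel P) (borel (X i)) setT _ (@open (X i))) => //.
move=> _ [B oB <-]; rewrite setTI.
apply: sub_sigma_algebra; apply: open_comp => // x _.
exact: prod_proj_continuous.
Qed.

Lemma rect_bigsetI (B : forall j, set (X j)) :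
  rect B = \big[setI/setT]_(j < n) [set x : P | B j (x j)].
Proof.
rewrite -bigcap_seq; apply/seteqP; split=> [x Bx j _|x Bx j]; first exact: Bx.
by apply: (Bx j) => /=; rewrite mem_index_enum.
Qed.

Lemma rect_measurable (B : forall j, set (X j)) :
  (forall j, measurable (B j : set (borel (X j)))) ->
  measurable (rect B : set (borel P)).
Proof.
move=> mB; rewrite rect_bigsetI; apply: bigsetI_measurable => j _.
by have := @prod_proj_measurable j measurableT _ (mB j); rewrite setTI.
Qed.

Lemma cylinder_rect (A : set P) : cylinder A -> measurable_rect A.
Proof.
move=> [i [B mB ->]]; exists (dfwith (fun j => setT) i B).
  by move=> j; case: dfwithP => // *; exact: measurableT.
apply/seteqP; split=> x /=.
  by move=> Bx j; case: dfwithP.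
by move=> /(_ i); rewrite dfwithin.
Qed.

(** The sets containing a box around [x] form a filter; as the product topology is a supremum of
    topologies pulled back from the factors, its convergence to [x] is checked one coordinate at a
    time. *)
Lemma prod_nbhs_rect (x : P) (A : set P) : nbhs x A ->
  exists2 U : forall j, set (X j), (forall j, nbhs (x j) (U j)) & rect U `<=` A.
Proof.
pose F : set_system P := [set A | exists2 U : forall j, set (X j),
  (forall j, nbhs (x j) (U j)) & rect U `<=` A].
have FF : Filter F.
  split.
  - by exists (fun=> setT) => // j; exact: filterT.
  - move=> C D [U nU UC] [V nV VD]; exists (fun j => U j `&` V j).
      by move=> j; exact: filterI.
    by move=> y UVy; split; [apply: UC|apply: VD] => j; case: (UVy j).
  - by move=> C D CD [U nU UC]; exists U => //; exact: subset_trans CD.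
suff : F --> x by apply.
apply/cvg_sup => i C [V [[W oW <-] Wx WC]].
exists (dfwith (fun j => setT) i W).
  move=> j; case: dfwithP => [|k _]; last exact: filterT.
  exact: open_nbhs_nbhs.
by move=> y /(_ i); rewrite dfwithin => Wy; apply: WC.
Qed.

(** [O] is the union of the boxes with basic sides that it contains, and finite families of basis
    indices are countable. *)
Lemma prod_open_rect (O : set P) : open O ->
  exists2 F : nat -> set P, (forall k, measurable_rect (F k)) &
    O = \bigcup_k F k.
Proof.
move=> oO.
pose W j := s2val (cid2 (polish_countable_basis (Xpolish j))).
have oW j k : open (W j k) by rewrite /W; case: cid2.
have Wb j x A : nbhs x A -> exists2 k, W j k x & W j k `<=` A.
  by rewrite /W; case: cid2 => /= ? _; exact.
pose B (phi : {ffun 'I_n -> nat}) := rect (fun j => W j (phi j)).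
have r0 : measurable_rect set0.
  exists (fun=> set0); first by move=> j; exact: measurable0.
  by apply/seteqP; split=> // x /(_ (Ordinal n_gt0)).
exists (fun k => if unpickle k is Some phi then
                   if `[< B phi `<=` O >] then B phi else set0 else set0).
  move=> k; case: unpickle => [phi|//]; case: asboolP => [_|//].
  exists (fun j => W j (phi j)) => // j.
  by apply: sub_sigma_algebra; exact: oW.
apply/seteqP; split=> [x Ox|x [k _]]; last first.
  by case: unpickle => [phi|//]; case: asboolP => [BO|//] /BO.
have [U nU UO] : exists2 U : forall j, set (X j),
    (forall j, nbhs (x j) (U j)) & rect U `<=` O.
  by apply: prod_nbhs_rect; exact: open_nbhs_nbhs.
have /choice[k Hk] : forall j, exists k, W j k (x j) /\ W j k `<=` U j.
  by move=> j; have [k] := Wb j _ _ (nU j); exists k.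
pose phi := [ffun j => k j].
exists (pickle phi) => //; rewrite pickleK.
case: asboolP => [_ j|[y By]]; first by rewrite ffunE; case: (Hk j).
by apply: UO => j; have [_] := Hk j; apply; have := By j; rewrite ffunE.
Qed.

Lemma rect_setI_closed : setI_closed measurable_rect.
Proof.
move=> _ _ [B mB ->] [C mC ->]; exists (fun j => B j `&` C j).
  by move=> j; exact: measurableI.
by apply/seteqP; split=> [x [Bx Cx] j|x BCx]; split => // j; case: (BCx j).
Qed.

Lemma borel_g_rect :
  (measurable : set (set (borel P))) = <<s measurable_rect >>.
Proof.
apply/seteqP; split; last first.
  apply: smallest_sub; first exact: sigma_algebra_measurable.
  by move=> _ [B mB ->]; exact: rect_measurable.
apply: smallest_sub; first exact: smallest_sigma_algebra.
move=> O /prod_open_rect[F rF ->]; apply: sigma_algebra_bigcup => k.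
exact: sub_sigma_algebra.
Qed.

(** Rectangles form a pi-system generating the Borel sets. *)
Lemma same_measure_rect (m1 m2 : borel_prob R P) :
  (forall A, measurable_rect A -> m1 A = m2 A) -> same_measure m1 m2.
Proof.
move=> m12 A mA.
apply: (@measure_unique _ R (borel P) measurable_rect (fun=> setT)) => //.
- exact: borel_g_rect.
- exact: rect_setI_closed.
- move=> _; exists (fun=> setT); first by move=> j; exact: measurableT.
  by apply/seteqP; split.
- by rewrite bigcup_const.
- by move=> _; rewrite (le_lt_trans (probability_le1 _ _))// ltry.
Qed.

Section plan_extension.
Variables (mu : forall j, borel_prob R (X j)) (L : set P -> R).
Hypothesis faL : finitely_additive_prob L.
Hypothesis Lmarg : forall j (B : set (X j)),
  measurable (B : set (borel (X j))) -> L [set x : P | B (x j)] = pr (mu j) B.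

(** Compact sets [K j] inside the sides have a compact product by Tychonoff. What is lost lies in
    the union of the cylinders over [B j] minus [K j], whose [L]-values are read off the
    marginals. *)
Lemma rect_compactly_regular (A : set P) :
  measurable_rect A -> compactly_regular L A.
Proof.
move=> [B mB ->] e e0.
(* With [n.+1] in the denominator, the [n] errors add up to strictly less than [e]. *)
have en : 0 < e / n.+1%:R by rewrite divr_gt0.
pose K j := sval (cid (polish_compactly_regular (mu j) (Xpolish j) (mB j) en)).
have HK j : [/\ compact (K j), closed (K j), K j `<=` B j &
    pr (mu j) (B j `\` K j) < e / n.+1%:R] by rewrite /K; case: cid.
have mK j : measurable (K j : set (borel (X j))).
  by apply: closed_borel; case: (HK j).
exists (rect K); split.
- by apply: tychonoff => j; case: (HK j).
- rewrite (_ : rect K = \bigcap_j ((fun x : P => x j) @^-1` K j)).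
    apply: closed_bigI => j _.
    apply: (continuous_closedP _).1; first exact: prod_proj_continuous.
    by case: (HK j).
  by apply/seteqP; split=> x Kx j; [move=> _|]; exact: Kx.
- by move=> x Kx j; have [_ _ + _] := HK j; apply; exact: Kx.
- pose D j := [set x : P | (B j `\` K j) (x j)].
  have mD j : measurable (D j : set (borel P)).
    have := @prod_proj_measurable j measurableT _ (measurableD (mB j) (mK j)).
    by rewrite setTI.
  apply: (@le_lt_trans _ _ (L (\big[setU/set0]_(j < n) D j))).
    apply: le_fap => //.
    + by apply: measurableD; exact: rect_measurable.
    + exact: bigsetU_measurable.
    + move=> x [Bx /existsNP[j Kx]]; rewrite -bigcup_seq.
      by exists j => /=; [rewrite mem_index_enum|split].
  apply: le_lt_trans (fap_bigsetU_le faL _ mD) _.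
  apply: (@le_lt_trans _ _ (\sum_(j < n) e / n.+1%:R)).
    apply: ler_sum => j _; rewrite Lmarg; last exact: measurableD.
    by apply: ltW; case: (HK j).
  rewrite sumr_const card_ord -[_ *+ n]mulr_natr mulrAC ltr_pdivrMr//.
  by rewrite ltr_pM2l// ltr_nat.
Qed.

Lemma plan_extension : exists gam : borel_prob R P, [/\ plans mu gam,
  forall A, measurable_rect A -> gam A = (L A)%:E &
  forall O : set P, open O -> (gam O <= (L O)%:E)%E].
Proof.
pose i0 : 'I_n := Ordinal n_gt0.
have cylT : cylinder setT.
  by exists i0; exists setT => //; exact: measurableT.
have cylC : setC_closed cylinder.
  move=> _ [i [B mB ->]]; exists i; exists (~` B) => //.
  exact: measurableC.
have cylG A : measurable_rect A -> smallest (@set_algebra P) cylinder A.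
  move=> [B mB ->]; rewrite rect_bigsetI; elim/big_ind: _ => [||j _].
  - exact: sub_gen_smallest.
  - by move=> C D; exact: g_algebraI.
  - by apply: sub_gen_smallest; exists j; exists (B j).
have [|A cA|O /prod_open_rect[F rF ->]|gam [gamE gamO]] :=
    compact_extension faL cylT cylC.
- by move=> A /cylinder_rect[B mB ->]; exact: rect_measurable.
- by apply: rect_compactly_regular; exact: cylinder_rect.
- by exists F => // k; exact: cylG.
exists gam; split => //; last by move=> A rA; apply: gamE; exact: cylG.
move=> i B mB; rewrite prE//; transitivity (L [set x : P | B (x i)])%:E.
  by apply: gamE; apply: sub_gen_smallest; exists i; exists B.
by rewrite Lmarg.
Qed.

End plan_extension.
End product.

(** * Limits along an ultrafilter *)

Section ultra_limit.
Variables (R : realType) (U : set_system nat).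
Hypothesis UU : UltraFilter U.

(** Compactness of the interval gives a cluster point, which for an ultrafilter is a limit. *)
Lemma ultra_cvg01 (u : nat -> R) : (forall k, 0 <= u k <= 1) ->
  exists l : R, u k @[k --> U] --> l.
Proof.
move=> u01.
have [|l [_ ul]] := @segment_compact R 0 1 (u @ U) _.
  by apply: (@filterE _ U) => k /=; rewrite in_itv/=; exact: u01.
exists l => A lA.
have [//|nA] := in_ultra_setVsetC (u @^-1` A) UU.
by have [y [nAy Ay]] := ul (~` A) A nA lA; exfalso; exact: nAy.
Qed.

Lemma ultra_limit_fap (T : ptopologicalType) (L_ : nat -> set T -> R) :
  (forall k, finitely_additive_prob (L_ k)) ->
  exists2 L : set T -> R, finitely_additive_prob L &
    forall A, measurable (A : set (borel T)) -> L_ k A @[k --> U] --> L A.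
Proof.
move=> faL.
have L01 k A : measurable (A : set (borel T)) -> 0 <= L_ k A <= 1.
  move=> mA; have [Lge0 LT _] := faL k; rewrite Lge0/= -LT.
  by apply: (le_fap (faL k)) => //; exact: measurableT.
(* The bound [L_ k A <= 1] comes from monotonicity on Borel sets; elsewhere the value 0 keeps [L]
   nonnegative. *)
pose L A := if `[< measurable (A : set (borel T)) >]
            then lim (L_ k A @[k --> U]) else 0.
have cL A : measurable (A : set (borel T)) -> L_ k A @[k --> U] --> L A.
  move=> mA; rewrite /L asboolT//.
  by have [l ll] := ultra_cvg01 (fun k => L01 k A mA); apply/cvg_ex; exists l.
exists L => //; split.
- move=> A; rewrite /L; case: asboolP => // mA.
  apply: limr_ge.
    by have [l ll] := ultra_cvg01 (fun k => L01 k A mA); apply/cvg_ex; exists l.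
  by apply: nearW => k; have /andP[] := L01 k A mA.
- have := cL setT measurableT => /cvg_lim <- //.
  apply: lim_near_cst => //; apply: nearW => k.
  by case: (faL k).
- move=> A B mA mB AB; have mAB := measurableU _ _ mA mB.
  have : L_ k (A `|` B) @[k --> U] --> L A + L B.
    rewrite (_ : (fun k => L_ k (A `|` B)) = (fun k => L_ k A + L_ k B)).
      by apply: cvgD; exact: cL.
    by apply/funext => k; case: (faL k) => _ _; exact.
  by move=> /cvg_lim <- //; apply/esym/cvg_lim => //; exact: cL.
Qed.

End ultra_limit.

(** * Superlevel sets and lower semicontinuity of the cost *)

Section level_sets.
Variables (R : realType) (T : ptopologicalType) (c : T -> \bar R).
Hypothesis c_ge0 : forall x, (0 <= c x)%E.
Hypothesis mc : measurable_fun [set: borel T] (c : borel T -> \bar R).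

Definition level (t : R) : set T := [set x | (t%:E < c x)%E].

Lemma level_measurable t : measurable (level t : set (borel T)).
Proof.
by have := emeasurable_fun_o_infty measurableT mc t%:E; rewrite setTI.
Qed.

(** A staircase below [c] with [N] steps of height [d]; its integral involves only the masses of
    superlevel sets. *)
Definition level_sum (d : R) (N : nat) (x : T) : \bar R :=
  (\sum_(j < N) d%:E * (\1_(level (j.+1%:R * d)) x)%:E)%E.

Lemma level_sumS d N x : level_sum d N.+1 x =
  (level_sum d N x + if (N.+1%:R * d)%:E < c x then d%:E else 0)%E.
Proof.
rewrite /level_sum big_ord_recr/= indicE; congr adde.
case: ifPn => h; first by rewrite mem_set ?mule1.
by rewrite memNset ?mule0//; apply/negP.
Qed.

Lemma level_sum_ge0 (d : R) N x : 0 <= d -> (0 <= level_sum d N x)%E.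
Proof. by move=> d0; apply: sume_ge0 => j _; rewrite mule_ge0// lee_fin. Qed.

(** Either [c x] exceeds [N d] and the staircase is saturated, or the staircase is within one step
    of [c x]. *)
Lemma level_sum_bounds (d : R) N x : 0 < d ->
  if ((N%:R * d)%:E < c x)%E then level_sum d N x = (N%:R * d)%:E
  else (c x <= level_sum d N x + d%:E)%E.
Proof.
move=> d0; elim: N => [|N ih].
  rewrite /level_sum big_ord0 mul0r; case: ifPn => //; rewrite -leNgt add0e.
  by move=> /le_trans; apply; rewrite lee_fin ltW.
have NS : N.+1%:R * d = N%:R * d + d by rewrite -natr1 mulrDl mul1r.
rewrite level_sumS; case: ifPn => h.
  have h' : ((N%:R * d)%:E < c x)%E.
    by apply: lt_trans h; rewrite lte_fin NS ltrDl.
  by move: ih; rewrite h h' => ->; rewrite NS EFinD.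
rewrite (negbTE h) adde0; case: ifPn ih => [_ ->|//].
by rewrite -EFinD -NS leNgt.
Qed.

Lemma level_sum_le (d : R) N x : 0 < d -> (level_sum d N x <= c x)%E.
Proof.
move=> d0; elim: N => [|N ih]; first by rewrite /level_sum big_ord0.
have := level_sum_bounds N.+1 x d0; case: ifPn => [h ->|h _]; first exact: ltW.
by rewrite level_sumS (negbTE h) adde0.
Qed.

Lemma mine_le_level_sum (d : R) N x : 0 < d ->
  (mine (c x) (N%:R * d)%:E <= level_sum d N x + d%:E)%E.
Proof.
move=> d0; have := level_sum_bounds N x d0; case: ifPn => [h ->|_ h].
  by rewrite ge_min; apply/orP; right; rewrite -EFinD lee_fin lerDl ltW.
by rewrite ge_min h.
Qed.

Lemma level_sum_measurable d N :
  measurable_fun [set: borel T] (level_sum d N : borel T -> \bar R).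
Proof.
apply: emeasurable_sum => j; apply: measurable_funeM.
apply/measurable_EFinP; apply: measurable_indic; exact: level_measurable.
Qed.

Lemma integral_level_sum (m : borel_prob R T) (d : R) N : 0 <= d ->
  (\int[m]_x level_sum d N x =
   (\sum_(j < N) d * pr m (level (j.+1%:R * d)))%:E)%E.
Proof.
move=> d0; rewrite /level_sum ge0_integral_sum//; last 2 first.
- move=> j; apply: measurable_funeM; apply/measurable_EFinP.
  by apply: measurable_indic; exact: level_measurable.
- by move=> j x _; rewrite mule_ge0// lee_fin.
rewrite -sumEFin; apply: eq_bigr => j _.
have mj := level_measurable (j.+1%:R * d).
rewrite ge0_integralZl_EFin//; last first.
  by apply/measurable_EFinP; exact: measurable_indic.
by rewrite integral_indic// setIT EFinM [in RHS]/pr fineK// fin_num_measure.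
Qed.

(** The truncation of [c] at height [N d] exceeds the staircase by at most [d]. The [gam]-integral
    of the staircase is at most the limit of its [gam_ k]-integrals, hence at most [M]. Letting the
    height grow and [d] vanish, monotone convergence concludes. *)
Lemma integral_le_level (U : set_system nat) (gam : borel_prob R T)
    (gam_ : nat -> borel_prob R T) (M : R) : ProperFilter U ->
  (forall t, exists2 l : R, pr (gam_ k) (level t) @[k --> U] --> l &
     pr gam (level t) <= l) ->
  (forall e, 0 < e -> \forall k \near U, (\int[gam_ k]_x c x <= (M + e)%:E)%E) ->
  (\int[gam]_x c x <= M%:E)%E.
Proof.
move=> PU lev costM.
have bound (d : R) N : 0 < d ->
    (\int[gam]_x mine (c x) (N%:R * d)%:E <= (M + d)%:E)%E.
  move=> d0; apply: (@le_trans _ _ (\int[gam]_x (level_sum d N x + d%:E))%E).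
    apply: ge0_le_integral => //.
    - by move=> x _; rewrite le_min c_ge0/= lee_fin mulr_ge0// ltW.
    - by apply: measurable_mine.
    - apply: emeasurable_funD => //; exact: level_sum_measurable.
    - by move=> x _; exact: mine_le_level_sum.
  rewrite ge0_integralD//; last 3 first.
  - by move=> x _; rewrite level_sum_ge0// ltW.
  - exact: level_sum_measurable.
  - by move=> x _; rewrite lee_fin ltW.
  rewrite integral_cst//= probability_setT mule1 EFinD leeD2r//.
  rewrite (integral_level_sum _ _ (ltW d0)) lee_fin.
  have [l Hl] : exists l : nat -> R, forall j,
      pr (gam_ k) (level (j.+1%:R * d)) @[k --> U] --> l j /\
      pr gam (level (j.+1%:R * d)) <= l j.
    have /choice[l Hl] : forall j : nat, exists l : R,
        pr (gam_ k) (level (j.+1%:R * d)) @[k --> U] --> l /\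
        pr gam (level (j.+1%:R * d)) <= l.
      by move=> j; have [l] := lev (j.+1%:R * d); exists l.
    by exists l.
  apply: (@le_trans _ _ (\sum_(j < N) d * l j)).
    by apply: ler_sum => j _; rewrite ler_pM2l//; case: (Hl j).
  have cS : \sum_(j < N) d * pr (gam_ k) (level (j.+1%:R * d)) @[k --> U]
      --> \sum_(j < N) d * l j.
    elim: N => [|N ih].
      under eq_fun do rewrite big_ord0.
      by rewrite big_ord0; exact: cvg_cst.
    under eq_fun do rewrite big_ord_recr/=.
    rewrite big_ord_recr/=; apply: cvgD => //.
    by apply: cvgMr; case: (Hl N).
  apply/ler_addgt0Pr => e e0; apply: (cvgr_to_le cS).
  apply: filterS (costM e e0) => k; apply: contraTT; rewrite -!ltNge => h.
  move: h; rewrite -lte_fin => /lt_le_trans; apply.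
  rewrite -(integral_level_sum _ _ (ltW d0)); apply: ge0_le_integral => //.
  - by move=> x _; rewrite level_sum_ge0// ltW.
  - exact: level_sum_measurable.
  - by move=> x _; exact: level_sum_le.
have cx x : (mine (c x) k%:R%:E)%E @[k --> \oo] --> c x.
  have := c_ge0 x; case: (c x) => [r _|_|//].
    apply: cvg_near_cst; apply: filterS (nbhs_infty_ger r) => k rk.
    by rewrite min_l// lee_fin.
  apply/cvgeyPge => r; apply: filterS (nbhs_infty_ger r) => k rk.
  by rewrite min_r ?leey// lee_fin.
have cmin :
    (\int[gam]_x mine (c x) k%:R%:E)%E @[k --> \oo] --> (\int[gam]_x c x)%E.
  have -> : (\int[gam]_x c x =
      \int[gam]_x limn (fun k => mine (c x) k%:R%:E))%E.
    by apply: eq_integral => x _; apply/esym/cvg_lim.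
  apply: cvg_monotone_convergence => //.
  - by move=> k; exact: measurable_mine.
  - by move=> k x _; rewrite le_min c_ge0/= lee_fin.
  - move=> x _ i j ij; rewrite le_min ge_min lexx/= ge_min.
    by apply/orP; right; rewrite lee_fin ler_nat.
apply/lee_addgt0Pr => e e0; rewrite -(cvg_lim _ cmin)//.
apply: lime_le; first by apply/cvg_ex; eexists; exact: cmin.
near=> k.
(* With steps of height [1 / (k+1)], [k (k+1)] of them reach the height [k] exactly. *)
have := bound k.+1%:R^-1 (k * k.+1)%N.
rewrite natrM -mulrA divff// mulr1 invr_gt0 => /(_ (ltr0Sn _ _)) /le_trans; apply.
rewrite -EFinD lee_fin lerD2l; apply: ltW; near: k.
exact: (near_infty_natSinv_lt (PosNum e0)).
Unshelve. all: by end_near. Qed.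

End level_sets.

(** * Transport plans *)

Section plans.
Variables (R : realType) (n : nat) (X : 'I_n -> ptopologicalType).
Hypothesis n_gt0 : (0 < n)%N.
Hypothesis Xpolish : forall j, polish R (X j).
Variable mu : forall j, borel_prob R (X j).
Local Notation P := (prod_space X).

(** The preimage of a rectangle is a product: the rectangle with its [i]-th side freed, times that
    side. *)
Lemma update_measurable (i : 'I_n) : measurable_fun setT
  (fun xy : borel P * borel (X i) => (dfwith xy.1 i xy.2 : borel P)).
Proof.
apply: (@measurability _ _ _ (borel P) setT _ (@measurable_rect n X)).
  exact: borel_g_rect.
move=> _ [_ [B mB ->] <-]; rewrite setTI.
rewrite (_ : _ @^-1` _ = rect (dfwith B i setT) `*` B i); last first.
  apply/seteqP; split=> -[x y] /=.
    move=> Bxy; split=> [j|]; last by have := Bxy i; rewrite dfwithin.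
    have := Bxy j; have [<-|ij] := eqVneq i j; first by rewrite !dfwithin.
    by rewrite !dfwithout.
  move=> [Bx By] j; have := Bx j; have [<-|ij] := eqVneq i j.
    by rewrite !dfwithin.
  by rewrite !dfwithout.
apply: measurableX; last exact: mB.
apply: rect_measurable => j; case: dfwithP => *; [exact: measurableT|exact: mB].
Qed.

(** Starting from a Dirac mass, coordinates are replaced one after the other by independent draws
    from the [mu i]. *)
Lemma plans_nonempty : exists pi : borel_prob R P, plans mu pi.
Proof.
suff /(_ n (leqnn n))[pi Hpi] : forall k, (k <= n)%N ->
    exists pi : borel_prob R P, forall j : 'I_n, (j < k)%N ->
      same_measure (borel_push pi (fun x : P => x j)) (mu j).
  by exists pi => j; exact: Hpi.
elim=> [_|k ih kn].
  by exists (dirac (point : borel P)).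
have [pi Hpi] := ih (ltnW kn); pose i := Ordinal kn.
pose m : {measure set (borel P * borel (X i)) -> \bar R} := (pi \x mu i)%E.
have mE (A : set (borel P)) (B : set (borel (X i))) :
    measurable A -> measurable B -> m (A `*` B) = (pi A * mu i B)%E.
  by move=> mA mB; exact: product_measure1E.
have [|pi' pi'E] := pushforward_probability (m := m) (@update_measurable i).
  by rewrite -setXTT mE// !probability_setT mule1.
exists pi' => j jk A mA; rewrite /borel_push /pushforward pi'E.
have [ij|ij] := eqVneq i j.
  subst j; rewrite (_ : _ @^-1` _ = setT `*` A); last first.
    by apply/seteqP; split=> -[x y] /=; rewrite dfwithin//; case.
  by rewrite mE// probability_setT mul1e.
rewrite (_ : _ @^-1` _ = [set x : P | A (x j)] `*` setT); last first.
  by apply/seteqP; split=> -[x y] /=; rewrite dfwithout//; case.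
rewrite mE//; last first.
  by have := @prod_proj_measurable _ X j measurableT _ mA; rewrite setTI.
rewrite probability_setT mule1; apply: Hpi => //.
move: jk ij; rewrite ltnS leq_eqVlt => /orP[/eqP jk|//] /eqP; case.
exact: val_inj.
Qed.

Definition marginals (L : set P -> R) : Prop :=
  forall j (B : set (X j)), measurable (B : set (borel (X j))) ->
    L [set x : P | B (x j)] = pr (mu j) B.

Lemma plans_marginals (pi : borel_prob R P) : plans mu pi -> marginals (pr pi).
Proof. by move=> Hpi j B mB; rewrite /pr -(Hpi j B mB). Qed.

(** Stated for set functions, so as to apply to sequences of plans and to Cesaro averages alike. The
    limit is exact on rectangles and one-sided on open sets. *)
Lemma plan_ultra_limit (U : set_system nat) (L_ : nat -> set P -> R) :
  UltraFilter U -> (forall k, finitely_additive_prob (L_ k)) ->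
  (forall k, marginals (L_ k)) ->
  exists gam : borel_prob R P, [/\ plans mu gam,
    forall A, measurable_rect A -> L_ k A @[k --> U] --> pr gam A &
    forall O : set P, open O ->
      exists2 l : R, L_ k O @[k --> U] --> l & pr gam O <= l].
Proof.
move=> UU faL marg; have [L faLL cL] := ultra_limit_fap UU faL.
have margL : marginals L.
  move=> j B mB.
  have mB' : measurable ([set x : P | B (x j)] : set (borel P)).
    by have := @prod_proj_measurable _ X j measurableT _ mB; rewrite setTI.
  have := cL _ mB' => /cvg_lim <- //.
  by apply: lim_near_cst => //; apply: nearW => k; exact: marg.
have [gam [pgam gamE gamO]] := plan_extension n_gt0 Xpolish faLL margL.
exists gam; split => //.
- move=> A rA; rewrite /pr gamE//=; apply: cL.
  by case: rA => B mB ->; exact: rect_measurable.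
- move=> O oO; have mO : measurable (O : set (borel P)).
    exact: sub_sigma_algebra.
  by exists (L O); [exact: cL|rewrite -lee_fin -prE//; exact: gamO].
Qed.

(** * Existence of a solution by the direct method *)

Variable c : P -> \bar R.
Hypothesis Hc : admissible_cost c.

Let c_ge0 x : (0 <= c x)%E. Proof. by case: Hc. Qed.
Let mc : measurable_fun [set: borel P] (c : borel P -> \bar R).
Proof. by case: Hc. Qed.
Let level_open t : open (level c t).
Proof. by case: Hc => _ /lower_semicontinuousP + _; exact. Qed.

Lemma MK_inf_le (pi : borel_prob R P) : plans mu pi ->
  (MK_inf mu c <= cost c pi)%E.
Proof. by move=> ppi; apply: ereal_inf_lbound; exists pi. Qed.

Lemma MK_solution_le (pi : borel_prob R P) : plans mu pi ->
  (cost c pi <= MK_inf mu c)%E -> MK_solution mu c pi.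
Proof.
by move=> ppi h; split=> //; apply/eqP; rewrite eq_le h MK_inf_le.
Qed.

Lemma MK_infP : MK_inf mu c = +oo%E \/ exists M : R, MK_inf mu c = M%:E.
Proof.
have : (0 <= MK_inf mu c)%E.
  by apply: le_ereal_inf_tmp => _ [pi _ <-]; exact: integral_ge0.
by case: (MK_inf mu c) => [M _||//]; [right; exists M|left].
Qed.

Lemma oo_ultra : exists2 U : set_system nat, UltraFilter U & \oo `<=` U.
Proof.
have [U [UU ooU]] := @ultraFilterLemma nat \oo _.
by exists U.
Qed.

Lemma MK_solution_exists : exists gam, MK_solution mu c gam.
Proof.
have [Minf|[M MK]] := MK_infP.
  have [pi ppi] := plans_nonempty; exists pi; apply: MK_solution_le => //.
  by rewrite Minf leey.
have /choice[gam_ Hgam] : forall k : nat, exists g : borel_prob R P,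
    plans mu g /\ (cost c g <= (M + k.+1%:R^-1)%:E)%E.
  move=> k; have : (MK_inf mu c < (M + k.+1%:R^-1)%:E)%E.
    by rewrite MK lte_fin ltrDl invr_gt0.
  by move=> /ereal_inf_lt[_ [g pg <-] /ltW]; exists g.
have [U UU ooU] := oo_ultra.
have [|k|gam [pgam _ gamO]] := plan_ultra_limit (L_ := fun k => pr (gam_ k)) UU.
- by move=> k; exact: pr_finitely_additive.
- by apply: plans_marginals; case: (Hgam k).
exists gam; apply: MK_solution_le => //; rewrite MK.
apply: (@integral_le_level _ _ _ c_ge0 mc U gam gam_) => [t|e e0].
  by apply: gamO; exact: level_open.
apply: ooU; apply: filterS (near_infty_natSinv_lt (PosNum e0)) => k ke.
have [_ /le_trans] := Hgam k; apply.
by rewrite lee_fin lerD2l ltW.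
Qed.

(** * Product maps and invariance tested on rectangles *)

Definition measurable_maps (f : forall j, X j -> X j) : Prop :=
  forall j, measurable_fun [set: borel (X j)] (f j : borel (X j) -> borel (X j)).

Lemma prod_map_rect (f : forall j, X j -> X j) A : measurable_maps f ->
  measurable_rect A -> measurable_rect (prod_map f @^-1` A).
Proof.
move=> mf [B mB ->]; exists (fun j => f j @^-1` B j) => // j.
by have := mf j measurableT _ (mB j); rewrite setTI.
Qed.

Lemma prod_map_measurable (f : forall j, X j -> X j) : measurable_maps f ->
  measurable_fun [set: borel P] (prod_map f : borel P -> borel P).
Proof.
move=> mf; apply: (@measurability _ _ _ (borel P) setT _ (@measurable_rect n X)).
  exact: borel_g_rect.
move=> _ [A rA <-]; rewrite setTI.
by have [B mB ->] := prod_map_rect mf rA; exact: rect_measurable.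
Qed.

Lemma invariant_under_rect (gam : borel_prob R P) f : measurable_maps f ->
  (forall A, measurable_rect A -> pr gam (prod_map f @^-1` A) = pr gam A) ->
  invariant_under gam f.
Proof.
move=> mf inv; have mF := prod_map_measurable mf.
have [|Q QE] := pushforward_probability (m := gam) mF.
  exact: probability_setT.
have h : same_measure gam Q.
  apply: same_measure_rect => // A rA; rewrite QE.
  have [B mB AE] := rA; have mA : measurable (A : set (borel P)).
    by rewrite AE; exact: rect_measurable.
  rewrite [LHS]prE// -inv// -prE//.
  by have := mF measurableT _ mA; rewrite setTI.
by move=> A mA; rewrite h// QE.
Qed.

(** * Cesaro averages of the push-forwards of a plan *)

Section cesaro.
Variables (gam : borel_prob R P) (f : forall j, X j -> X j).
Arguments f : clear implicits.
Hypothesis gamP : plans mu gam.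
Hypothesis mpf : forall j, measure_preserving (mu j) (f j).
Let F : borel P -> borel P := prod_map f.

Let mf : measurable_maps f. Proof. by move=> j; case: (mpf j). Qed.

Definition orbit_pr (A : set P) (i : nat) : R := pr gam (iter i F @^-1` A).

Definition cesaro (k : nat) (A : set P) : R :=
  k.+1%:R^-1 * \sum_(0 <= i < k.+1) orbit_pr A i.

Lemma iter_measurable i : measurable_fun setT (iter i F).
Proof.
elim: i => [|i ih]; first exact: measurable_id.
by apply: measurableT_comp ih; exact: prod_map_measurable.
Qed.

Lemma iter_preimage_measurable i (A : set (borel P)) : measurable A ->
  measurable (iter i F @^-1` A).
Proof. by move=> mA; have := @iter_measurable i measurableT _ mA; rewrite setTI. Qed.

Lemma cesaro_fap k : finitely_additive_prob (cesaro k).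
Proof.
have fag := pr_finitely_additive gam.
split=> [A||A B mA mB AB].
- by rewrite mulr_ge0// sumr_ge0// => i _; case: fag => ge0 _ _; exact: ge0.
- rewrite /cesaro (eq_bigr (fun=> 1)); last first.
    by move=> i _; rewrite /orbit_pr preimage_setT; case: fag.
  by rewrite sumr_const_nat subn0 mulVf.
- rewrite /cesaro -mulrDr -big_split/=; congr (_ * _); apply: eq_bigr => i _.
  rewrite /orbit_pr preimage_setU; case: fag => _ _; apply.
  + exact: iter_preimage_measurable.
  + exact: iter_preimage_measurable.
  + by rewrite -preimage_setI AB preimage_set0.
Qed.

Lemma iter_preserving j i (B : set (borel (X j))) : measurable B ->
  measurable (iter i (f j) @^-1` B : set (borel (X j))) /\
  pr (mu j) (iter i (f j) @^-1` B) = pr (mu j) B.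
Proof.
move=> mB; elim: i => [//|i [mi ih]]; have [mfj inv] := mpf j.
have -> : iter i.+1 (f j) @^-1` B = f j @^-1` (iter i (f j) @^-1` B).
  by apply/seteqP; split=> x /=; rewrite -iterSr.
split; first by have := mfj measurableT _ mi; rewrite setTI.
by rewrite -ih; congr fine; exact: inv.
Qed.

Lemma cesaro_marginals k : marginals (cesaro k).
Proof.
move=> j B mB; rewrite /cesaro (eq_bigr (fun=> pr (mu j) B)).
  by rewrite sumr_const_nat subn0 -[pr _ _ *+ _]mulr_natl mulKf.
move=> i _; rewrite -(iter_preserving i mB).2.
rewrite -(plans_marginals gamP (iter_preserving i mB).1).
congr (pr gam _); apply/seteqP; split=> x /=;
  rewrite (_ : iter i F x j = iter i (f j) (x j))//; by elim: i => //= i <-.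
Qed.

(** The difference telescopes to two values in [0, 1], divided by [k.+1]. *)
Lemma cesaro_shift k A : measurable (A : set (borel P)) ->
  `|cesaro k (F @^-1` A) - cesaro k A| <= k.+1%:R^-1.
Proof.
move=> mA; rewrite /cesaro -mulrBr -sumrB.
rewrite (eq_bigr (fun i => orbit_pr A i.+1 - orbit_pr A i)); last by [].
rewrite telescope_sumr// normrM ger0_norm ?invr_ge0//.
rewrite ler_piMr ?invr_ge0//.
have o01 i : 0 <= orbit_pr A i <= 1.
  have [ge0 gT _] := pr_finitely_additive gam; rewrite /orbit_pr ge0/= -gT.
  apply: (le_fap (pr_finitely_additive gam)) => //.
  exact: iter_preimage_measurable.
by have := o01 k.+1; have := o01 0%N; rewrite ler_norml; lra.
Qed.

(** Meant for the superlevel sets of an invariant cost, which averaging therefore does not see. *)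
Lemma cesaro_invariant_set k A : F @^-1` A = A -> cesaro k A = pr gam A.
Proof.
move=> FA; rewrite /cesaro (eq_bigr (fun=> pr gam A)).
  by rewrite sumr_const_nat subn0 -[pr _ _ *+ _]mulr_natl mulKf.
move=> i _; congr (pr gam _); elim: i => [//|i ih].
by rewrite -[in RHS]ih -[in RHS]FA.
Qed.

(** [prod_map g] commutes with the iterates of [F], so it can be moved next to [gam], where
    invariance absorbs it. *)
Lemma cesaro_commute k A (g : forall j, X j -> X j) :
  (forall j, g j \o f j = f j \o g j) -> invariant_under gam g ->
  measurable (A : set (borel P)) ->
  cesaro k (prod_map g @^-1` A) = cesaro k A.
Proof.
move=> gf inv mA; congr (_ * _); apply: eq_bigr => i _; rewrite /orbit_pr.
have comm x : prod_map g (F x) = F (prod_map g x).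
  apply: functional_extensionality_dep => j.
  exact: (congr1 (fun h => h (x j)) (gf j)).
rewrite (_ : iter i F @^-1` _ = prod_map g @^-1` (iter i F @^-1` A)).
  by apply/esym; congr fine; apply: inv; exact: iter_preimage_measurable.
have iterg x : prod_map g (iter i F x) = iter i F (prod_map g x).
  by elim: i => //= i <-.
by apply/seteqP; split=> x /=; rewrite iterg.
Qed.

End cesaro.

(** The Krylov-Bogoliubov argument applied to a solution. The last clause preserves the symmetries
    already gained when several maps are treated in turn. *)
Lemma MK_solution_invariant (gam0 : borel_prob R P) f :
  MK_solution mu c gam0 -> (forall j, measure_preserving (mu j) (f j)) ->
  (forall x, c x = c (prod_map f x)) ->
  exists gam, [/\ MK_solution mu c gam, invariant_under gam f &
    forall g : forall j, X j -> X j, measurable_maps g ->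
      (forall j, g j \o f j = f j \o g j) -> invariant_under gam0 g ->
      invariant_under gam g].
Proof.
move=> [pgam0 cgam0] mpf cf.
have mf : measurable_maps f by move=> j; case: (mpf j).
have [U UU ooU] := oo_ultra.
have [|k|gam [pgam gamE gamO]] := plan_ultra_limit (L_ := cesaro gam0 f) UU.
- exact: cesaro_fap.
- exact: cesaro_marginals.
exists gam; split.
- apply: MK_solution_le => //.
  have [->|[M MK]] := MK_infP; first by rewrite leey.
  rewrite MK.
  (* The averages and [gam0] have the same mass on superlevel sets of [c], so the constant sequence
     [gam0] can stand for the averages. *)
  apply: (@integral_le_level _ _ _ c_ge0 mc U gam (fun=> gam0)) => [t|e e0].
    have [l cl lel] := gamO _ (level_open t); exists l => //.
    move: cl; rewrite (_ : (fun k => cesaro _ _ _ _) = fun=> pr gam0 (level c t))//.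
    apply/funext => k; apply: cesaro_invariant_set.
    by apply/seteqP; split=> x; rewrite /level/= -cf.
  by apply: nearW => k; rewrite -/(cost _ _) cgam0 MK lee_fin lerDl ltW.
- apply: invariant_under_rect => // A rA.
  have mA : measurable (A : set (borel P)).
    by case: rA => B mB ->; exact: rect_measurable.
  (* [A] and its preimage are both rectangles, so [gam] takes on them the limits of averages that
     differ by at most [1 / (k+1)]. *)
  have c1 := gamE _ rA; have c2 := gamE _ (prod_map_rect mf rA).
  have c0 : cesaro gam0 f k (prod_map f @^-1` A) - cesaro gam0 f k A
      @[k --> U] --> (0 : R).
    apply/cvgrPdist_lt => e e0; apply: ooU.
    apply: filterS (near_infty_natSinv_lt (PosNum e0)) => k ke.
    by rewrite sub0r normrN (le_lt_trans (cesaro_shift _ _ _ mA)).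
  apply/eqP; rewrite -subr_eq0; apply/eqP.
  by rewrite -(cvg_lim _ c0)//; apply/esym/cvg_lim => //; exact: cvgB.
- move=> g mg gf inv; apply: invariant_under_rect => // A rA.
  have mA : measurable (A : set (borel P)).
    by case: rA => B mB ->; exact: rect_measurable.
  have := gamE _ (prod_map_rect mg rA).
  under eq_fun do rewrite cesaro_commute//.
  by move=> /cvg_lim <- //; apply/cvg_lim => //; exact: gamE.
Qed.

(** Averaging [g_ k] along [f_ k] gives [g_ k.+1], so [g_ k] is a solution invariant under every
    [f_ i] with [i < k]. An ultrafilter limit of the [g_ k] is still a solution and is invariant
    under all of them. *)
Lemma MK_solution_invariant_seq (f_ : nat -> forall j, X j -> X j) :
  (forall i j, measure_preserving (mu j) (f_ i j)) ->
  (forall i x, c x = c (prod_map (f_ i) x)) ->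
  (forall i k j, f_ i j \o f_ k j = f_ k j \o f_ i j) ->
  exists2 gam, MK_solution mu c gam & forall i, invariant_under gam (f_ i).
Proof.
move=> mpf cf comm.
have mf i : measurable_maps (f_ i) by move=> j; case: (mpf i j).
(* Optimality is assumed under the existential so that [s] is a total function; its value at a
   non-solution is arbitrary. *)
have /choice[s Hs] : forall p : borel_prob R P * nat,
    exists gam, MK_solution mu c p.1 -> [/\ MK_solution mu c gam,
      invariant_under gam (f_ p.2) &
      forall i, invariant_under p.1 (f_ i) -> invariant_under gam (f_ i)].
  move=> [g0 k]; have [sg0|nsg0] := pselect (MK_solution mu c g0); last first.
    by exists g0.
  have [gam [sgam inv keep]] := MK_solution_invariant sg0 (mpf k) (cf k).
  by exists gam => _; split => // i; apply: keep.
have [g0 sg0] := MK_solution_exists.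
pose g_ := fix g_ k := if k is k'.+1 then s (g_ k', k') else g0.
have sg k : MK_solution mu c (g_ k).
  by elim: k => [//|k ih]; have [] := Hs (g_ k, k) ih.
have invg i k : (i < k)%N -> invariant_under (g_ k) (f_ i).
  elim: k => [//|k ih]; have [_ inv keep] := Hs (g_ k, k) (sg k).
  by rewrite ltnS leq_eqVlt => /orP[/eqP -> //|/ih]; exact: keep.
have [U UU ooU] := oo_ultra.
have [|k|gam [pgam gamE gamO]] := plan_ultra_limit (L_ := fun k => pr (g_ k)) UU.
- by move=> k; exact: pr_finitely_additive.
- by apply: plans_marginals; case: (sg k).
exists gam.
  apply: MK_solution_le => //.
  have [->|[M MK]] := MK_infP; first by rewrite leey.
  rewrite MK; apply: (@integral_le_level _ _ _ c_ge0 mc U gam g_) => [t|e e0].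
    by apply: gamO; exact: level_open.
  apply: nearW => k; have [_ h] := sg k.
  by rewrite -/(cost _ _) h MK lee_fin lerDl ltW.
move=> i; apply: invariant_under_rect => // A rA.
have mA : measurable (A : set (borel P)).
  by case: rA => B mB ->; exact: rect_measurable.
have c1 := gamE _ rA; have c2 := gamE _ (prod_map_rect (mf i) rA).
apply/eqP; rewrite -subr_eq0; apply/eqP; rewrite -(cvg_lim _ (cvgB c2 c1))//.
(* From [k = i.+1] on, [g_ k] is invariant under [f_ i], so the difference is eventually zero. *)
apply: lim_near_cst => //; apply: ooU; exists i.+1 => // k /= ik.
apply/eqP; rewrite subr_eq0; apply/eqP/esym; congr fine.
exact: (invg i k ik A mA).
Qed.

End plans.

(** * Invariance under a product map and under a countable commuting family *)

Theorem theorem1p7 (R : realType) (n : nat) (n_gt0 : (0 < n)%N) :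
  (forall (X : 'I_n -> ptopologicalType)
          (mu : forall j : 'I_n, borel_prob R (X j))
          (c : prod_space X -> \bar R)
          (f : forall j : 'I_n, X j -> X j),
     (forall j : 'I_n, polish R (X j)) ->
     admissible_cost c ->
     (forall j : 'I_n, measure_preserving (mu j) (f j)) ->
     (forall x : prod_space X, c x = c (prod_map f x)) ->
     exists gam : borel_prob R (prod_space X),
       MK_solution mu c gam /\ invariant_under gam f)
  /\
  (forall (X : ptopologicalType)
          (mu : borel_prob R X)
          (c : prod_space (fun _ : 'I_n => X) -> \bar R)
          (G : set (X -> X)),
     polish R X ->
     admissible_cost c ->
     (forall U : X -> X, G U -> measure_preserving mu U) ->
     (forall U : X -> X, G U -> forall x : prod_space (fun _ : 'I_n => X),
        c x = c (prod_map (fun _ : 'I_n => U) x)) ->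
     (forall U V : X -> X, G U -> G V -> U \o V = V \o U) ->
     countable G ->
     exists gam : borel_prob R (prod_space (fun _ : 'I_n => X)),
       MK_solution (fun _ : 'I_n => mu) c gam /\
       forall U : X -> X, G U -> invariant_under gam (fun _ : 'I_n => U)).
Proof.
split=> [X mu c f Xp Hc mpf cf|].
  have [gam0 sgam0] := MK_solution_exists n_gt0 Xp mu Hc.
  have [gam [sgam inv _]] := MK_solution_invariant n_gt0 Xp Hc sgam0 mpf cf.
  by exists gam.
move=> X mu c G Xp Hc mpG cG comm /countable_injP[e einj].
(* A nonempty [G] is enumerated with one of its elements [V] as default; if [G] is empty, any
   solution will do. *)
have [[V GV]|G0] := pselect (exists V, G V); last first.
  have [gam sgam] := MK_solution_exists n_gt0 (fun=> Xp) (fun=> mu) Hc.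
  by exists gam; split=> // U GU; exfalso; apply: G0; exists U.
pose u k := xget V [set U | G U /\ e U = k].
have Gu k : G (u k) by rewrite /u; case: xgetP => // U _ [].
have uE U : G U -> u (e U) = U.
  move=> GU; rewrite /u; case: xgetP => [W _ [GW eW]|/(_ U)[]//].
  by apply: einj => //; exact: mem_set.
have [|||gam sgam inv] := MK_solution_invariant_seq n_gt0 (fun=> Xp) Hc
    (mu := fun=> mu) (f_ := fun k _ => u k).
- by move=> i j; exact: mpG.
- by move=> i; exact: cG.
- by move=> i k j; exact: comm.
by exists gam; split=> // U GU; rewrite -(uE U GU); exact: inv.
Qed.
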